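(* Let $\theta\in\mathbb{R}$ be fixed. For each $n$, suppose $\mathbf{X}\sim\mathbb{P}_{\mathbf{Q},\boldsymbol{\mu}}$ follows the Ising model on $\{\pm1\}^n$, where $\mathbf{Q}$ is the scaled adjacency matrix of the cycle graph of length $n$, that is, $\mathbf{Q}_{i,j}=\theta/2$ if $i-j\equiv\pm1 \pmod n$ and $\mathbf{Q}_{i,j}=0$ otherwise. Consider testing $H_0:\boldsymbol{\mu}=\mathbf{0}$ versus $H_1:\boldsymbol{\mu}\in\Xi(s,B)$, where $s=s_n$ and $B=B_n$ may depend on $n$. If $s\tanh(B)\le C\sqrt n$ for some constant $C>0$, then no test is asymptotically powerful for this testing problem.
   Context: The Ising model with parameters $\mathbf{Q}$ (an $n\times n$ real symmetric matrix with zero diagonal) and $\boldsymbol{\mu}=(\mu_1,\dots,\mu_n)^\top\in\mathbb{R}^n$ is the probability distribution on $\{\pm1\}^n$ $$\mathbb{P}_{\mathbf{Q},\boldsymbol{\mu}}(\mathbf{X}=\mathbf{x})=\frac{1}{Z(\mathbf{Q},\boldsymbol{\mu})}\exp\Big(\tfrac12\mathbf{x}^\top\mathbf{Q}\mathbf{x}+\boldsymbol{\mu}^\top\mathbf{x}\Big),\qquad \mathbf{x}\in\{\pm1\}^n,$$ where $Z(\mathbf{Q},\boldsymbol{\mu})$ is the normalizing constant. For $s\in\{1,\dots,n\}$ and $B>0$, $$\Xi(s,B)=\Big\{\boldsymbol{\mu}\in\mathbb{R}^n: |\mathrm{supp}(\boldsymbol{\mu})|=s,\ \min_{i\in\mathrm{supp}(\boldsymbol{\mu})}\mu_i\ge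 B\Big\},\qquad \mathrm{supp}(\boldsymbol{\mu})=\{1\le i\le n:\mu_i\neq0\}.$$ A test is a function $T:\{\pm1\}^n\to\{0,1\}$, where the value $1$ means rejecting $H_0$. Its worst-case risk is $$\mathrm{Risk}(T)=\mathbb{P}_{\mathbf{Q},\mathbf{0}}(T(\mathbf{X})=1)+\sup_{\boldsymbol{\mu}\in\Xi(s,B)}\mathbb{P}_{\mathbf{Q},\boldsymbol{\mu}}(T(\mathbf{X})=0).$$ A sequence of tests (indexed by $n$) is asymptotically powerful if $\limsup_{n\to\infty}\mathrm{Risk}(T)=0$. All asymptotics are as $n\to\infty$ (with $n\ge3$). *)

(* Defs.v *)
From HB Require Import structures.
From mathcomp Require Import all_boot all_order all_algebra.
From mathcomp Require Import all_classical all_reals all_analysis.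
Set Implicit Arguments.
Unset Strict Implicit.
Unset Printing Implicit Defensive.
Import Order.TTheory GRing.Theory Num.Theory.
Local Open Scope ring_scope.

Definition tanh (R : realType) (x : R) : R :=
  (expR x - expR (- x)) / (expR x + expR (- x)).

(* A configuration in {-1, 1}^n is stored as a boolean function;
   [spin x] is the vector it encodes. *)
Definition config (n : nat) := {ffun 'I_n -> bool}.

Definition spin (R : realType) (n : nat) (x : config n) : 'cV[R]_n :=
  \col_i (if x i then 1 else -1).

Definition ising_weight (R : realType) (n : nat) (Q : 'M[R]_n) (mu : 'cV[R]_n)
    (x : config n) : R :=
  expR (2^-1 * ((spin R x)^T *m Q *m spin R x) 0 0 + (mu^T *m spin R x) 0 0).

Definition ising_Z (R : realType) (n : nat) (Q : 'M[R]_n) (mu : 'cV[R]_n) : R :=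
  \sum_(x : config n) ising_weight Q mu x.

Definition ising_pmf (R : realType) (n : nat) (Q : 'M[R]_n) (mu : 'cV[R]_n)
    (x : config n) : R :=
  (ising_Z Q mu)^-1 * ising_weight Q mu x.

Definition ising_prob (R : realType) (n : nat) (Q : 'M[R]_n) (mu : 'cV[R]_n)
    (A : {set config n}) : R :=
  \sum_(x in A) ising_pmf Q mu x.

Definition supp (R : realType) (n : nat) (mu : 'cV[R]_n) : {set 'I_n} :=
  [set i | mu i 0 != 0].

Definition Xi (R : realType) (n s : nat) (B : R) : set 'cV[R]_n :=
  [set mu | #|supp mu| = s /\ forall i, i \in supp mu -> B <= mu i 0]%classic.

(* The value [true] means that the null hypothesis is rejected. *)
Definition test (n : nat) := config n -> bool.

Definition risk (R : realType) (n : nat) (Q : 'M[R]_n) (s : nat) (B : R)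
    (T : test n) : \bar R :=
  ((ising_prob Q 0 [set x | T x])%:E +
   ereal_sup [set (ising_prob Q mu [set x | ~~ T x])%:E
             | mu in @Xi R n s B]%classic)%E.

Definition asymptotically_powerful (R : realType) (Q : forall n, 'M[R]_n)
    (s : nat -> nat) (B : nat -> R) (T : forall n, test n) : Prop :=
  limn_esup (fun n => risk (Q n) (s n) (B n) (T n)) = 0%E.

(* i - j = 1 or -1 modulo n, written without subtraction on naturals. *)
Definition cycle_adj (n : nat) : rel 'I_n :=
  fun i j => (i == j + 1 %[mod n])%N || (j == i + 1 %[mod n])%N.

Definition cycleQ (R : realType) (theta : R) (n : nat) : 'M[R]_n :=
  \matrix_(i, j) (if cycle_adj i j then theta / 2 else 0).

(* Main.v *)
Require Import Defs.
From HB Require Import structures.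
From mathcomp Require Import all_boot all_order all_algebra.
From mathcomp Require Import all_classical all_reals all_analysis.
From mathcomp Require Import ring lra zify.
Import Order.TTheory GRing.Theory Num.Theory.
Local Open Scope ring_scope.

(* The prior on alternatives cuts s * m sites, m = n / s, into s blocks of size m
   and plants one field B in each block; weighting each choice by its normaliser
   makes the mixture likelihood ratio proportional to
     L = \prod_b (1 + u_b),   u_b = tanh B * (mean of block b).
   It suffices that L has bounded mean under the null and is bounded below with
   non-negligible probability.  Sums of spins under the null are subgaussian: the
   cycle is comparable, up to a factor depending on theta only, to an open chain,
   whose transfer recursion contracts the linear exponent by tanh (theta / 2).
   Hence L <= exp (\sum_b u_b) has bounded mean as s * tanh B = O(sqrt n), and
   second and fourth moments bound \sum_b u_b, \sum_b u_b^2 and every |u_b|, so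
   that 1 + u >= exp (u - 2 u^2) keeps L away from 0. *)

Set Implicit Arguments.
Unset Strict Implicit.

(** * Exponential estimates *)

Definition pm (R : realType) (b : bool) : R := if b then 1 else -1.

Lemma pm_sqr (R : realType) (b : bool) : pm R b * pm R b = 1.
Proof. by case: b; rewrite /pm ?mulrNN mulr1. Qed.

Section Exponential.
Variable R : realType.
Implicit Types x y a tau : R.

(** Here [expR y] is the inverse square of [expR (- (y / 2))], which is at least [1 - y / 2 > 0]; a
    polynomial inequality remains. *)
Lemma expR_le_quadratic y : y <= 1 -> expR y <= 1 + y + 2 * y ^+ 2.
Proof.
move=> y2.
have e0 : 0 < expR (- (y / 2)) by exact: expR_gt0.
have e1 : 1 - y / 2 <= expR (- (y / 2)) by have := expR_ge1Dx (- (y / 2)).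
have -> : expR y = (expR (- (y / 2)) ^+ 2)^-1.
  by rewrite expr2 -expRD -expRN; congr expR; field.
have p0 : 0 < 1 + y + 2 * y ^+ 2 by have := sqr_ge0 (4 * y + 1); lra.
rewrite invf_ple ?posrE ?exprn_gt0 //.
apply: le_trans (_ : (1 - y / 2) ^+ 2 <= _); last first.
  by rewrite ler_pXn2r // nnegrE; [lra|exact: ltW].
rewrite -(ler_pM2r p0) mulVf ?gt_eqF //.
(* [(1 - y / 2) ^+ 2 * (1 + y + 2 * y ^+ 2) - 1] is a quarter of this product. *)
suff : 0 <= y ^+ 2 * ((5 - 2 * y) * (1 - y)) by lra.
apply: mulr_ge0; first exact: sqr_ge0.
by apply: mulr_ge0; lra.
Qed.

Lemma expR_le_id_gauss y : expR y <= y + expR (2 * y ^+ 2).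
Proof.
have [y1|y1] := leP 1 y.
  apply: le_trans (_ : expR (2 * y ^+ 2) <= _); last by lra.
  by rewrite ler_expR; nra.
apply: le_trans (expR_le_quadratic _) _; first lra.
have := expR_ge1Dx (2 * y ^+ 2); lra.
Qed.

(* [expR (+- u) / (expR u + expR (- u))] are the probabilities of a sign with mean
   [tanh u]; its centred exponents [y * (1 - tanh u)] and [- y * (1 + tanh u)]
   average to 0, so the linear terms of [expR_le_id_gauss] cancel. *)
Lemma two_point_mgf u y :
  expR u * expR y + expR (- u) * expR (- y) <=
  (expR u + expR (- u)) * expR (tanh u * y + 8 * y ^+ 2).
Proof.
set P := expR u; set Q := expR (- u); set tau := tanh u.
have P0 : 0 < P := expR_gt0 _.
have Q0 : 0 < Q := expR_gt0 _.
have tauE : tau * (P + Q) = P - Q.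
  by rewrite /tau /tanh -/P -/Q divfK // gt_eqF // addr_gt0.
have tau1 : tau <= 1 by nra.
have tauN1 : -1 <= tau by nra.
have H1 : expR (y * (1 - tau)) <= y * (1 - tau) + expR (8 * y ^+ 2).
  (* The 8 is [2 * 2 ^+ 2], since [1 - tau] lies between 0 and 2. *)
  apply: le_trans (expR_le_id_gauss _) _; rewrite lerD2l ler_expR.
  have : 0 <= y ^+ 2 := sqr_ge0 _.
  have : (1 - tau) ^+ 2 <= 4 by nra.
  rewrite exprMn; nra.
have H2 : expR (- (y * (1 + tau))) <= - (y * (1 + tau)) + expR (8 * y ^+ 2).
  apply: le_trans (expR_le_id_gauss _) _; rewrite lerD2l ler_expR.
  have : 0 <= y ^+ 2 := sqr_ge0 _.
  have : (1 + tau) ^+ 2 <= 4 by nra.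
  rewrite sqrrN exprMn; nra.
have E0 := expR_gt0 (tau * y).
have -> : expR y = expR (tau * y) * expR (y * (1 - tau)).
  by rewrite -expRD; congr expR; ring.
have -> : expR (- y) = expR (tau * y) * expR (- (y * (1 + tau))).
  by rewrite -expRD; congr expR; ring.
rewrite expRD !(mulrCA _ (expR (tau * y))) -mulrDr ler_pM2l //.
have H3 := ler_wpM2l (ltW P0) H1.
have H4 := ler_wpM2l (ltW Q0) H2.
apply: le_trans (lerD H3 H4) _.
rewrite [leLHS](_ : _ = y * (P - Q - tau * (P + Q)) + (P + Q) * expR (8 * y ^+ 2)).
  by rewrite tauE subrr mulr0 add0r.
by ring.
Qed.

Lemma sqr_le_expR x : 0 <= x -> x ^+ 2 <= 2 * expR x.
Proof.
move=> x0; have := expR_ge1Dxn 1 x0.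
by rewrite -[2`!]/2%N; lra.
Qed.

Lemma quart_le_expR x : 0 <= x -> x ^+ 4 <= 24 * expR x.
Proof.
move=> x0; have := expR_ge1Dxn 3 x0.
by rewrite -[4`!]/24%N; lra.
Qed.

(** The left side is at most the inverse of [1 - x + 2 * x ^+ 2], and multiplying that polynomial by
    [1 + x] gives [1 + x ^+ 2 * (1 + 2 * x)], at least 1 in this range. *)
Lemma expR_le_1D x : - 2^-1 <= x -> expR (x - 2 * x ^+ 2) <= 1 + x.
Proof.
move=> x0.
have q0 : 0 < 1 - x + 2 * x ^+ 2 by nra.
have : 1 - x + 2 * x ^+ 2 <= expR (- (x - 2 * x ^+ 2)).
  by have := expR_ge1Dx (- (x - 2 * x ^+ 2)); lra.
rewrite expRN => H.
have e0 := expR_gt0 (x - 2 * x ^+ 2).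
have := ler_wpM2l (ltW e0) H; rewrite mulfV ?gt_eqF // => H2.
have : 0 <= x ^+ 2 * (1 + 2 * x) by apply: mulr_ge0; [exact: sqr_ge0|lra].
move=> H3; nra.
Qed.

Lemma tanh_lt1 x : tanh x < 1.
Proof.
rewrite /tanh ltr_pdivrMr ?addr_gt0 ?expR_gt0 // mul1r.
by have := expR_gt0 (- x); lra.
Qed.

Lemma tanh_gtN1 x : -1 < tanh x.
Proof.
rewrite /tanh ltr_pdivlMr ?addr_gt0 ?expR_gt0 //.
by have := expR_gt0 x; lra.
Qed.

Lemma tanh_gt0 x : 0 < x -> 0 < tanh x.
Proof.
move=> x0; apply: divr_gt0; last by rewrite addr_gt0 ?expR_gt0.
by rewrite subr_gt0 ltr_expR; lra.
Qed.

(** A function of a sign is affine in it; this is what makes the mixture likelihood ratio a product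
    of factors [1 + block_mean]. *)
Lemma expR_pm x (b : bool) :
  expR (x * pm R b) =
  (expR x + expR (- x)) / 2 * (1 + tanh x * pm R b).
Proof.
have := expR_gt0 x; have := expR_gt0 (- x).
by case: b; rewrite /pm /tanh ?mulr1 ?mulrN1 => ? ?; field; rewrite gt_eqF ?addr_gt0.
Qed.
End Exponential.

(** * Subgaussian spins on the cycle *)

Definition config_cons (k : nat) (b : bool) (y : config k) : config k.+1 :=
  [ffun i => if unlift ord0 i is Some j then y j else b].

Lemma config_cons0 k b (y : config k) : config_cons b y ord0 = b.
Proof. by rewrite ffunE unlift_none. Qed.

Lemma config_consS k b (y : config k) j : config_cons b y (lift ord0 j) = y j.
Proof. by rewrite ffunE liftK. Qed.

Lemma big_config_recl (V : nmodType) k (F : config k.+1 -> V) :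
  \sum_x F x = \sum_(b : bool) \sum_(y : config k) F (config_cons b y).
Proof.
rewrite pair_big /=.
rewrite (reindex (fun p : bool * config k => config_cons p.1 p.2)) //=.
exists (fun x : config k.+1 => (x ord0, [ffun j => x (lift ord0 j)])).
  move=> [b y] _ /=; rewrite config_cons0; congr pair.
  by apply/ffunP => j; rewrite ffunE config_consS.
move=> x _ /=; apply/ffunP => i; rewrite ffunE.
by case: unliftP => [j ->|->]; rewrite ?ffunE.
Qed.

(** * The open chain and its transfer recursion *)

Section OpenChain.
Variables (R : realType) (u : R).
Implicit Types (h : nat -> R) (k : nat).

Definition chain_energy k (x : config k.+1) : R :=
  \sum_(i < k) pm R (x (widen_ord (leqnSn k) i)) * pm R (x (lift ord0 i)).

Lemma chain_energy_cons k b (y : config k.+1) :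
  chain_energy (config_cons b y) = pm R b * pm R (y ord0) + chain_energy y.
Proof.
rewrite /chain_energy big_ord_recl config_consS.
have -> : widen_ord (leqnSn k.+1) ord0 = ord0 by exact: val_inj.
rewrite config_cons0; congr (_ + _); apply: eq_bigr => i _.
have -> : widen_ord (leqnSn k.+1) (lift ord0 i) = lift ord0 (widen_ord (leqnSn k) i).
  exact: val_inj.
by rewrite !config_consS.
Qed.

(* Partition function of the open chain whose leftmost spin, which carries no
   field, is frozen to [b]. *)
Definition chain_Z h k (b : bool) : R :=
  \sum_(y : config k)
    expR (u * chain_energy (config_cons b y) + \sum_(i < k) h i * pm R (y i)).

Lemma chain_Z0 h b : chain_Z h 0 b = 1.
Proof.
rewrite /chain_Z (eq_bigr (fun=> 1)); last first.
  by move=> y _; rewrite /chain_energy !big_ord0 mulr0 addr0 expR0.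
by rewrite sumr_const card_ffun card_ord expn0.
Qed.

Lemma chain_ZS h k b :
  chain_Z h k.+1 b =
  \sum_(c : bool) expR (u * (pm R b * pm R c) + h 0 * pm R c) *
    chain_Z (fun i => h i.+1) k c.
Proof.
rewrite /chain_Z big_config_recl; apply: eq_bigr => c _.
rewrite mulr_sumr; apply: eq_bigr => y _.
rewrite -expRD chain_energy_cons big_ord_recl config_cons0; congr expR.
under eq_bigr do rewrite config_consS.
ring.
Qed.

Let kappa : R := expR u + expR (- u).

Lemma kappa_gt0 : 0 < kappa. Proof. by rewrite addr_gt0 ?expR_gt0. Qed.

Lemma sum_two_point (a : R) b :
  \sum_(c : bool) expR (u * (pm R b * pm R c) + a * pm R c) =
  expR u * expR (pm R b * a) + expR (- u) * expR (- (pm R b * a)).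
Proof.
rewrite big_bool -!expRD; case: b; rewrite /pm /=; last rewrite [LHS]addrC.
  by congr (expR _ + expR _); ring.
by congr (expR _ + expR _); ring.
Qed.

Lemma chain_Z_free k b : chain_Z (fun=> 0) k b = kappa ^+ k.
Proof.
elim: k b => [|k IH] b; first by rewrite chain_Z0.
rewrite chain_ZS; under eq_bigr do rewrite IH.
by rewrite -mulr_suml sum_two_point mulr0 oppr0 expR0 !mulr1 exprS.
Qed.

(* The potential [lam * a ^+ 2] absorbs the cost [8 * (h + a) ^+ 2] of one site,
   because the transfer step multiplies [a] by [tanh u]. *)
Lemma potential_constants : exists lam D : R, [/\ 0 <= lam, 0 <= D &
  forall h a : R,
    lam * (tanh u * (h + a)) ^+ 2 + 8 * (h + a) ^+ 2 <=
    lam * a ^+ 2 + D * h ^+ 2].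
Proof.
set rho := tanh u ^+ 2.
have rho0 : 0 <= rho := sqr_ge0 _.
have rho1 : rho < 1.
  have := tanh_lt1 u; have := tanh_gtN1 u; rewrite /rho; nra.
set eta := (1 - rho) / 2.
have eta0 : 0 < eta by rewrite /eta; lra.
(* With 12, the product [M * (1 + eta)] below equals [lam - 4 - 16 * eta], hence is at most
   [lam]. *)
set lam := 12 / eta.
have lam0 : 0 < lam by rewrite divr_gt0.
have lamE : lam * eta = 12 by rewrite /lam divfK // gt_eqF.
set M := lam * rho + 8.
have M0 : 0 < M by rewrite /M; nra.
exists lam, (M * (1 + eta^-1)); split; first exact: ltW.
  by rewrite mulr_ge0 ?(ltW M0) // addr_ge0 // invr_ge0 ltW.
move=> h a.
rewrite exprMn -/rho [leLHS](_ : _ = M * (h + a) ^+ 2); last by rewrite /M; ring.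
have H1 : (h + a) ^+ 2 <= (1 + eta) * a ^+ 2 + (1 + eta^-1) * h ^+ 2.
  rewrite -subr_ge0 [leRHS](_ : _ = eta * (a - h / eta) ^+ 2).
    by rewrite mulr_ge0 ?sqr_ge0 // ltW.
  by field; rewrite gt_eqF.
apply: le_trans (ler_wpM2l (ltW M0) H1) _.
rewrite mulrDr (mulrA M (1 + eta^-1)) lerD2r mulrA.
apply: ler_wpM2r; first exact: sqr_ge0.
have rhoE : rho = 1 - 2 * eta by rewrite /eta; field.
have : M * (1 + eta) = lam + (lam * eta) * (1 - 2 * eta) - 2 * (lam * eta) + 8 + 8 * eta.
  by rewrite /M rhoE; ring.
rewrite lamE => ->; nra.
Qed.

Lemma chain_Z_subgaussian : exists2 D : R, 0 <= D &
  forall h k, exists b,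
    chain_Z h k b <= kappa ^+ k * expR (D * \sum_(i < k) h i ^+ 2).
Proof.
have [lam [D [lam0 D0 step]]] := potential_constants.
exists D => // h k.
suff [a [beta [Hab HZ]]] : exists a beta : R,
    lam * a ^+ 2 + beta <= D * \sum_(i < k) h i ^+ 2 /\
    forall b, chain_Z h k b <= kappa ^+ k * expR (pm R b * a + beta).
  (* This boundary sign makes [pm R b * a] nonpositive, so the linear term drops. *)
  exists (a <= 0); apply: le_trans (HZ _) _.
  rewrite ler_wpM2l ?exprn_ge0 ?(ltW kappa_gt0) // ler_expR.
  have : 0 <= lam * a ^+ 2 by rewrite mulr_ge0 // sqr_ge0.
  by rewrite /pm; case: (leP a 0) => ?; lra.
elim: k h => [|k IH] h.
  exists 0, 0; split; first by rewrite big_ord0 expr2 !mulr0 addr0.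
  by move=> b; rewrite chain_Z0 expr0 mulr0 addr0 expR0 mulr1.
have [a [beta [Hab HZ]]] := IH (fun i => h i.+1).
set a' := h 0%N + a.
(* These are the slope and cost that [two_point_mgf] yields when a spin in total field [a'] is
   summed out. *)
exists (tanh u * a'), (8 * a' ^+ 2 + beta); split.
  rewrite big_ord_recl /= (mulrDr D).
  under eq_bigr => i _ do rewrite -[bump 0 i]/(i.+1).
  have := step (h 0%N) a; rewrite -/a'.
  move: Hab. lra.
move=> b; rewrite chain_ZS.
apply: le_trans (_ : \sum_c expR (u * (pm R b * pm R c) + a' * pm R c) *
   (kappa ^+ k * expR beta) <= _).
  apply: ler_sum => c _.
  apply: le_trans (ler_wpM2l (expR_ge0 _) (HZ c)) _.
  rewrite mulrCA [leRHS]mulrCA ler_wpM2l ?exprn_ge0 ?(ltW kappa_gt0) //.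
  by rewrite -!expRD ler_expR le_eqVlt; apply/orP; left; apply/eqP; rewrite /a'; ring.
rewrite -mulr_suml sum_two_point.
have := two_point_mgf u (pm R b * a').
rewrite -/kappa exprMn [pm R b ^+ 2]expr2 pm_sqr mul1r => H.
apply: le_trans (ler_wpM2r _ H) _.
  by rewrite mulr_ge0 ?expR_ge0 // exprn_ge0 // ltW // kappa_gt0.
rewrite mulrACA -exprS -expRD ler_wpM2l ?exprn_ge0 ?(ltW kappa_gt0) //.
by rewrite ler_expR le_eqVlt; apply/orP; left; apply/eqP; ring.
Qed.
End OpenChain.

(** * Comparison of the cycle with the open chain *)

Section Cycle.
Variables (R : realType) (theta : R).

(** With at least three sites the two directions of adjacency exclude each other, so the disjunction
    in [cycle_adj] can be written as a sum of indicators. *)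
Lemma ordS_ordS_neq n (j : 'I_n.+3) : j != ordS (ordS j).
Proof.
apply/eqP => /(congr1 val) /=.
rewrite -[(_ %% _).+1]addn1 modnDml addn1.
have jn : (j < n.+3)%N := ltn_ord j.
have [j2|j2] := ltnP j.+2 n.+3; first by rewrite modn_small //; lia.
by rewrite -(subnK j2) modnDr modn_small; lia.
Qed.

Lemma cycleQE n (i j : 'I_n.+3) :
  cycleQ theta n.+3 i j =
  theta / 2 * (i == ordS j)%:R + theta / 2 * (j == ordS i)%:R.
Proof.
rewrite mxE /cycle_adj.
have E (a b : 'I_n.+3) : (a == b + 1 %[mod n.+3])%N = (a == ordS b).
  by rewrite -val_eqE /= addn1 modn_small.
rewrite !E; case: eqP => [->|_] /=; last first.
  by case: eqP => _; rewrite ?mulr0 ?mulr1 ?add0r.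
case: eqP => [|_]; last by rewrite mulr0 mulr1 addr0.
by move/eqP; rewrite (negPf (ordS_ordS_neq j)).
Qed.

(** The symmetric form counts each edge twice, which cancels the prefactor [2^-1] and leaves
    coupling [theta / 2] per edge. *)
Lemma cycle_quadratic_form n (x : config n.+3) :
  2^-1 * ((spin R x)^T *m cycleQ theta n.+3 *m spin R x) 0 0 =
  theta / 2 * \sum_i pm R (x i) * pm R (x (ordS i)).
Proof.
have spinE i : spin R x i 0 = pm R (x i) by rewrite mxE.
have E : \sum_j \sum_i pm R (x i) * (theta / 2 * (i == ordS j)%:R) * pm R (x j)
   = theta / 2 * \sum_i pm R (x i) * pm R (x (ordS i)).
  rewrite mulr_sumr; apply: eq_bigr => j _.
  rewrite (bigD1 (ordS j)) //= eqxx big1 => [|i /negPf ->]; last first.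
    by rewrite !mulr0 mul0r.
  by rewrite mulr1 addr0; ring.
rewrite mxE.
under eq_bigr => j _.
  rewrite mxE big_distrl /= spinE.
  under eq_bigr => i _ do rewrite cycleQE mxE spinE mulrDr mulrDl.
  rewrite big_split /=; over.
rewrite big_split /= E.
rewrite exchange_big /=.
rewrite [X in _ + X](_ : _ = theta / 2 * \sum_i pm R (x i) * pm R (x (ordS i))).
  by field.
rewrite -E; apply: eq_bigr => i _; apply: eq_bigr => j _; ring.
Qed.

Lemma cycle_sum_recr n (x : config n.+1) :
  \sum_i pm R (x i) * pm R (x (ordS i)) =
  chain_energy R x + pm R (x ord_max) * pm R (x ord0).
Proof.
rewrite big_ord_recr /=; congr (_ + _ * pm R (x _)); last first.
  by apply: val_inj; rewrite /= modnn.
apply: eq_bigr => i _; congr (_ * pm R (x _)).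
by apply: val_inj; rewrite /= modn_small // ltnS.
Qed.

Lemma ising_weight0 n (x : config n) (Q : 'M[R]_n) :
  ising_weight Q 0 x = expR (2^-1 * ((spin R x)^T *m Q *m spin R x) 0 0).
Proof. by rewrite /ising_weight trmx0 mul0mx [in X in _ + X]mxE addr0. Qed.

Lemma ising_weight_split n (x : config n) (Q : 'M[R]_n) mu :
  ising_weight Q mu x = ising_weight Q 0 x * expR (\sum_i mu i 0 * pm R (x i)).
Proof.
rewrite ising_weight0 /ising_weight -expRD.
congr (expR (_ + _)); rewrite mxE; apply: eq_bigr => i _.
by rewrite !mxE.
Qed.

Lemma cycle_chain_weight n (x : config n.+3) b :
  expR (- `|theta|) * expR (theta / 2 * chain_energy R (config_cons b x)) <=
  ising_weight (cycleQ theta n.+3) 0 x <=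
  expR `|theta| * expR (theta / 2 * chain_energy R (config_cons b x)).
Proof.
rewrite ising_weight0 cycle_quadratic_form cycle_sum_recr chain_energy_cons.
rewrite -!expRD !ler_expR.
have : `|theta / 2 * (pm R (x ord_max) * pm R (x ord0) - pm R b * pm R (x ord0))|
       <= `|theta|.
  rewrite -[leRHS](divfK (_ : 2 != 0 :> R)) // normrM normrM normfV (ger0_norm (ler0n _ 2)).
  rewrite ler_wpM2l ?divr_ge0 // /pm ler_norml.
  by case: (x ord_max); case: (x ord0); case: b; apply/andP; split; lra.
by rewrite ler_norml => /andP[? ?]; apply/andP; split; lra.
Qed.

Definition null_mean n (f : config n -> R) : R :=
  \sum_x ising_pmf (cycleQ theta n) 0 x * f x.

Lemma ising_weight_gt0 n (Q : 'M[R]_n) mu x : 0 < ising_weight Q mu x.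
Proof. exact: expR_gt0. Qed.

Lemma ising_Z_gt0 n (Q : 'M[R]_n) mu : 0 < ising_Z Q mu.
Proof.
rewrite /ising_Z (bigD1 [ffun=> true]) //= ltr_wpDr ?ising_weight_gt0 //.
by apply: sumr_ge0 => x _; exact/ltW/ising_weight_gt0.
Qed.

Lemma ising_pmf_ge0 n (Q : 'M[R]_n) mu x : 0 <= ising_pmf Q mu x.
Proof.
by rewrite mulr_ge0 ?invr_ge0 ?(ltW (ising_Z_gt0 _ _)) ?(ltW (ising_weight_gt0 _ _ _)).
Qed.

Lemma null_mean1 n : null_mean (fun _ : config n => 1) = 1.
Proof.
rewrite /null_mean; under eq_bigr do rewrite mulr1.
by rewrite -mulr_sumr mulVf // gt_eqF // ising_Z_gt0.
Qed.

Lemma ler_null_mean n (f g : config n -> R) :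
  (forall x, f x <= g x) -> null_mean f <= null_mean g.
Proof. by move=> fg; apply: ler_sum => x _; rewrite ler_wpM2l ?ising_pmf_ge0. Qed.

Lemma null_meanD n (f g : config n -> R) :
  null_mean (fun x => f x + g x) = null_mean f + null_mean g.
Proof. by rewrite -big_split; apply: eq_bigr => x _; rewrite mulrDr. Qed.

Lemma null_meanZ n a (f : config n -> R) :
  null_mean (fun x => a * f x) = a * null_mean f.
Proof. by rewrite mulr_sumr; apply: eq_bigr => x _; rewrite mulrCA. Qed.

Lemma null_mean_sum n (I : finType) (f : I -> config n -> R) :
  null_mean (fun x => \sum_i f i x) = \sum_i null_mean (f i).
Proof. by rewrite exchange_big; apply: eq_bigr => x _; rewrite mulr_sumr. Qed.

(** Numerator and normaliser are compared with the same frozen chain, each at the cost of a factor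
    [expR (normr theta)]; the powers of [kappa] cancel. *)
Lemma null_mean_expR : exists K D : R, [/\ 0 < K, 0 <= D &
  forall n (h : 'I_n -> R), (3 <= n)%N ->
    null_mean (fun x => expR (\sum_i h i * pm R (x i))) <=
    K * expR (D * \sum_i h i ^+ 2)].
Proof.
have [D D0 HD] := chain_Z_subgaussian (theta / 2).
exists (expR `|theta| * expR `|theta|), D; split; [by rewrite mulr_gt0 ?expR_gt0|by []|].
case=> [|[|[|n]]] // h _.
(* Chain fields are indexed by naturals, so [h] is extended by 0. *)
pose hn i := oapp h 0 (insub i).
have hnE (i : 'I_n.+3) : hn i = h i by rewrite /hn valK.
have [b Hb] := HD hn n.+3.
have kp := exprn_gt0 n.+3 (kappa_gt0 (theta / 2)).
move: Hb kp; set kap := _ ^+ _ => Hb kp.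
have ZE : expR (- `|theta|) * kap <= ising_Z (cycleQ theta n.+3) 0.
  rewrite /kap -(chain_Z_free _ _ b) mulr_sumr; apply: ler_sum => x _.
  rewrite big1 => [|i _]; last by rewrite mul0r.
  by rewrite addr0; case/andP: (cycle_chain_weight x b).
have NE : \sum_x ising_weight (cycleQ theta n.+3) 0 x * expR (\sum_i h i * pm R (x i))
    <= expR `|theta| * (kap * expR (D * \sum_i h i ^+ 2)).
  under [X in D * X]eq_bigr do rewrite -hnE.
  apply: le_trans (ler_wpM2l (expR_ge0 _) Hb).
  rewrite mulr_sumr; apply: ler_sum => x _.
  under [X in expR (_ + X)]eq_bigr do rewrite hnE.
  rewrite expRD mulrA ler_wpM2r ?expR_ge0 //.
  by case/andP: (cycle_chain_weight x b).
rewrite /null_mean /ising_pmf.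
under eq_bigr do rewrite -mulrA.
rewrite -mulr_sumr ler_pdivrMl ?ising_Z_gt0 //.
apply: le_trans NE _; rewrite [leRHS]mulrC.
have := ler_wpM2l (_ : 0 <= expR `|theta| * expR `|theta| * expR (D * \sum_i h i ^+ 2)) ZE.
rewrite !mulr_ge0 ?expR_ge0 // => /(_ isT).
apply: le_trans; rewrite expRN le_eqVlt; apply/orP; left; apply/eqP.
by field; rewrite gt_eqF ?expR_gt0.
Qed.
End Cycle.

(** * Spin sums and the mixture likelihood ratio *)

Section SpinSums.
Variables (R : realType) (theta : R).

(** A general index type serves both a single block and the union of all blocks. *)
Definition spin_sum n (J : finType) (f : J -> 'I_n) (x : config n) : R :=
  \sum_j pm R (x (f j)).

Lemma spin_sum_mgf : exists K D : R, [/\ 0 < K, 0 <= D &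
  forall n (J : finType) (f : J -> 'I_n) a, (3 <= n)%N -> injective f ->
    null_mean theta (fun x => expR (a * spin_sum f x)) <=
    K * expR (D * (a ^+ 2 * #|J|%:R))].
Proof.
have [K [D [K0 D0 HKD]]] := null_mean_expR theta.
exists K, D; split=> // n J f a n3 finj.
have Hsum (F : 'I_n -> R) :
    \sum_i (if i \in [set f j | j in J] then F i else 0) = \sum_j F (f j).
  by rewrite -big_mkcond big_imset //= => i j _ _; exact: finj.
have := HKD n (fun i => if i \in [set f j | j in J] then a else 0) n3.
under [X in _ <= K * expR (D * X)]eq_bigr => i _.
  rewrite (_ : _ ^+ 2 = if i \in [set f j | j in J] then a ^+ 2 else 0); last first.
    by case: ifP => //; rewrite expr2 mul0r.
  over.
rewrite Hsum sumr_const -[a ^+ 2 *+ _]mulr_natr; apply: le_trans.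
apply: ler_null_mean => x; rewrite ler_expR /spin_sum mulr_sumr.
rewrite -(Hsum (fun i => a * pm R (x i))) le_eqVlt; apply/orP; left; apply/eqP.
by apply: eq_bigr => i _; case: ifP => //; rewrite mul0r.
Qed.

(** At [a = +- v^-1], with [v ^+ 2] the number of spins, the exponential moment is at most
    [K * expR D]; [x ^+ k <= k! * expR x] at [x = normr (spin_sum f x) / v] turns this into
    moments. *)
Lemma spin_sum_moments : exists2 M : R, 0 < M &
  forall n (J : finType) (f : J -> 'I_n), (3 <= n)%N -> injective f ->
    (0 < #|J|)%N ->
    null_mean theta (fun x => spin_sum f x ^+ 2) <= M * #|J|%:R /\
    null_mean theta (fun x => spin_sum f x ^+ 4) <= M * #|J|%:R ^+ 2.
Proof.
have [K [D [K0 D0 HKD]]] := spin_sum_mgf.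
have KD0 : 0 < K * expR D by rewrite mulr_gt0 ?expR_gt0.
(* 48 is 2 for the two signs of the exponent times the 24 of [quart_le_expR]; the second moment
   needs only 4. *)
exists (48 * (K * expR D)); first by rewrite mulr_gt0.
move=> n J f n3 finj J0.
have nJ0 : 0 < #|J|%:R :> R by rewrite ltr0n.
set v := Num.sqrt (#|J|%:R : R).
have v2 : v ^+ 2 = #|J|%:R by rewrite sqr_sqrtr // ltW.
have v0 : 0 < v by rewrite sqrtr_gt0.
have mgf a : a ^+ 2 = (v ^+ 2)^-1 ->
    null_mean theta (fun x => expR (a * spin_sum f x)) <= K * expR D.
  move=> av; apply: le_trans (HKD n J f a n3 finj) _.
  by rewrite av v2 mulVf ?mulr1 // gt_eqF.
have mgfp := mgf v^-1 (exprVn _ _).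
have mgfn : null_mean theta (fun x => expR (- v^-1 * spin_sum f x)) <= K * expR D.
  by apply: mgf; rewrite sqrrN exprVn.
have abs_le x : expR (`|spin_sum f x| / v) <=
    expR (v^-1 * spin_sum f x) + expR (- v^-1 * spin_sum f x).
  rewrite mulrC; have [_|_] := ger0P (spin_sum f x).
    by rewrite lerDl expR_ge0.
  by rewrite mulrN mulNr lerDr expR_ge0.
have moment (k : nat) (c : R) :
    0 <= c -> (forall x : R, 0 <= x -> x ^+ k <= c * expR x) -> ~~ odd k ->
    null_mean theta (fun x => spin_sum f x ^+ k) <= 2 * c * (K * expR D) * v ^+ k.
  move=> c0 Hc ek.
  have vk : 0 < v ^+ k by rewrite exprn_gt0.
  apply: le_trans (_ : null_mean theta (fun x => c * v ^+ k *
    (expR (v^-1 * spin_sum f x) + expR (- v^-1 * spin_sum f x))) <= _).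
    apply: ler_null_mean => x.
    have := Hc (`|spin_sum f x| / v); rewrite divr_ge0 ?(ltW v0) // => /(_ isT).
    rewrite expr_div_n ler_pdivrMr // -normrX ger0_norm; last first.
      by rewrite exprn_even_ge0.
    move=> /le_trans; apply; rewrite mulrAC ler_wpM2l //.
    by rewrite mulr_ge0 // ltW.
  rewrite null_meanZ null_meanD.
  rewrite [leRHS](_ : _ = c * v ^+ k * (K * expR D + K * expR D)); last by ring.
  by rewrite ler_wpM2l ?lerD // mulr_ge0 // ltW.
split.
  apply: le_trans (moment 2%N 2 _ (@sqr_le_expR R) _) _ => //.
  by rewrite v2; nra.
apply: le_trans (moment 4%N 24 _ (@quart_le_expR R) _) _ => //.
by rewrite -[4%N]/(2 * 2)%N exprM v2; lra.
Qed.
End SpinSums.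

(** * The mixture over planted fields *)

Section Mixture.
Variables (R : realType) (theta : R) (n s m : nat).
Variable (g : 'I_s * 'I_m -> 'I_n).
Hypothesis (g_inj : injective g) (m_gt0 : (0 < m)%N).

(** Site [j] of block [b] sits at [g (b, j)], and [phi] selects the planted site of each block. *)
Definition planted (B : R) (phi : {ffun 'I_s -> 'I_m}) : 'cV[R]_n :=
  \col_i (if i \in [set g (b, phi b) | b in 'I_s] then B else 0).

Lemma choice_inj (phi : {ffun 'I_s -> 'I_m}) : injective (fun b => g (b, phi b)).
Proof. by move=> b c /g_inj []. Qed.

Lemma planted_Xi B phi : 0 < B -> Xi s B (planted B phi).
Proof.
move=> B0.
have suppE : supp (planted B phi) = [set g (b, phi b) | b in 'I_s].
  by apply/setP => i; rewrite inE mxE; case: ifP => _; rewrite ?eqxx // gt_eqF.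
split; first by rewrite suppE card_imset ?card_ord //; exact: choice_inj.
by move=> i; rewrite suppE mxE => ->.
Qed.

Definition block_mean (a : R) (b : 'I_s) (x : config n) : R :=
  a / m%:R * spin_sum R (fun j => g (b, j)) x.

Definition mixture_lr (a : R) (x : config n) : R :=
  \prod_b (1 + block_mean a b x).

(** The choices in distinct blocks are independent, so the sum over [phi] factors over blocks, and
    [expR_pm] linearises each factor. *)
Lemma sum_planted_tilt B (x : config n) :
  \sum_phi expR (\sum_i planted B phi i 0 * pm R (x i)) =
  (m%:R * ((expR B + expR (- B)) / 2)) ^+ s * mixture_lr (tanh B) x.
Proof.
have m0 : m%:R != 0 :> R by rewrite pnatr_eq0 -lt0n.
transitivity (\prod_(b < s) \sum_(j < m) expR (B * pm R (x (g (b, j))))).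
  rewrite bigA_distr_bigA; apply: eq_bigr => phi _.
  rewrite -expR_sum; congr expR.
  under eq_bigr => i _.
    rewrite mxE (_ : _ * _ = if i \in [set g (b, phi b) | b in 'I_s]
                              then B * pm R (x i) else 0); last first.
      by case: ifP => //; rewrite mul0r.
    over.
  by rewrite -big_mkcond big_imset //= => b c _ _; exact: choice_inj.
have powE (c : R) : c ^+ s = \prod_(b < s) c by rewrite prodr_const card_ord.
rewrite /mixture_lr powE -big_split /=.
apply: eq_bigr => b _.
under eq_bigr do rewrite expR_pm.
rewrite -mulr_sumr big_split /= sumr_const card_ord -mulr_sumr.
rewrite /block_mean /spin_sum; field.
exact: m0.
Qed.

(* Weighting each planted field by its normaliser turns the mixture likelihood
   ratio into the explicit product [mixture_lr]. *)
Lemma mixture_type2 B (T : test n) r :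
  (forall phi, ising_prob (cycleQ theta n) (planted B phi) [set x | ~~ T x] <= r) ->
  null_mean theta (fun x => mixture_lr (tanh B) x * (~~ T x)%:R) <=
  r * null_mean theta (mixture_lr (tanh B)).
Proof.
move=> Hr.
set w := fun phi (x : config n) => expR (\sum_i planted B phi i 0 * pm R (x i)).
(* [null_mean theta (w phi)] is the ratio of the normalisers under [planted B phi] and under the
   null, so this is [Hr phi] multiplied by that ratio. *)
have Hphi phi : null_mean theta (fun x => w phi x * (~~ T x)%:R) <=
    r * null_mean theta (w phi).
  have Z0 := ising_Z_gt0 (cycleQ theta n) 0.
  have := Hr phi; rewrite /ising_prob /ising_pmf -mulr_sumr.
  rewrite ler_pdivrMl ?ising_Z_gt0 // => H.
  rewrite /null_mean /ising_pmf.
  under eq_bigr do rewrite -mulrA.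
  under [X in _ <= _ * X]eq_bigr do rewrite -mulrA.
  rewrite -!mulr_sumr mulrCA ler_wpM2l ?invr_ge0 ?(ltW Z0) //.
  move: H; rewrite mulrC /ising_Z big_mkcond /= => H.
  apply: le_trans (_ : _ <= _) (le_trans H _); rewrite le_eqVlt; apply/orP; left; apply/eqP.
    apply: eq_bigr => x _; rewrite inE (ising_weight_split _ _ (planted B phi)).
    by case: (T x); rewrite /= ?mulr0 ?mulr1.
  by congr (_ * _); apply: eq_bigr => x _; rewrite (ising_weight_split _ _ (planted B phi)).
have : \sum_phi null_mean theta (fun x => w phi x * (~~ T x)%:R) <=
    \sum_phi r * null_mean theta (w phi) by apply: ler_sum => phi _.
rewrite -mulr_sumr -!null_mean_sum /w.
set c := (m%:R * ((expR B + expR (- B)) / 2)) ^+ s.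
have c0 : 0 < c.
  by rewrite exprn_gt0 // mulr_gt0 ?ltr0n // divr_gt0 ?addr_gt0 ?expR_gt0.
rewrite (_ : null_mean theta _ =
  c * null_mean theta (fun x => mixture_lr (tanh B) x * (~~ T x)%:R)); last first.
  rewrite -null_meanZ; apply: eq_bigr => x _; congr (_ * _).
  by rewrite -mulr_suml sum_planted_tilt -/c mulrA.
rewrite (_ : null_mean theta (fun x => \sum_phi _) =
  c * null_mean theta (mixture_lr (tanh B))); last first.
  by rewrite -null_meanZ; apply: eq_bigr => x _; rewrite sum_planted_tilt.
by rewrite mulrCA ler_pM2l.
Qed.
End Mixture.

(** Truncation in pointwise form: the bracket is at most 0 unless the sums are below [A] and every
    [v i] is at least [- 2^-1], where [expR_le_1D] applies. It is affine in the power sums, so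
    moment bounds suffice to average it. *)
Lemma prod_1D_ge (R : realType) (I : finType) (v : I -> R) (A : R) :
  0 < A -> (forall i, -1 <= v i) ->
  expR (- (1 + 2 * A)) *
    (1 - (((\sum_i v i) ^+ 2 + \sum_i v i ^+ 2) / A + 16 * \sum_i v i ^+ 4)) <=
  \prod_i (1 + v i).
Proof.
move=> A0 v1; set S := \sum_i v i; set S2 := \sum_i _ ^+ 2; set S4 := \sum_i _ ^+ 4.
have S2_ge0 : 0 <= S2 by apply: sumr_ge0 => i _; exact: sqr_ge0.
have S4_ge0 : 0 <= S4 by apply: sumr_ge0 => i _; rewrite exprn_even_ge0.
have prod_ge0 : 0 <= \prod_i (1 + v i) by apply: prodr_ge0 => i _; have := v1 i; lra.
have e0 := expR_gt0 (- (1 + 2 * A)).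
have [Phi_ge1|Phi_lt1] := leP 1 ((S ^+ 2 + S2) / A + 16 * S4).
  by apply: le_trans prod_ge0; rewrite mulr_ge0_le0 ?(ltW e0) //; lra.
have SA0 : 0 <= (S ^+ 2 + S2) / A by rewrite divr_ge0 ?(ltW A0) // addr_ge0 // sqr_ge0.
have SA : S ^+ 2 + S2 < A by rewrite -[ltRHS]mul1r -ltr_pdivrMr //; lra.
have v_half i : - 2^-1 <= v i.
  have : v i ^+ 4 <= S4.
    by rewrite /S4 (bigD1 i) //= lerDl sumr_ge0 // => j _; rewrite exprn_even_ge0.
  rewrite -[4%N]/(2 * 2)%N exprM => v4.
  have := sqr_ge0 (v i) => v2.
  have : v i ^+ 2 < 4^-1 by nra.
  nra.
apply: le_trans (_ : expR (- (1 + 2 * A)) <= _).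
  by rewrite ger_pMr //; lra.
apply: le_trans (_ : \prod_i expR (v i - 2 * v i ^+ 2) <= _); last first.
  by apply: ler_prod => i _; rewrite expR_ge0 expR_le_1D.
rewrite -expR_sum ler_expR sumrB -mulr_sumr -/S -/S2.
have := sqr_ge0 (S + 1); have := sqr_ge0 S; nra.
Qed.

Lemma prod_1D_le (R : realType) (I : finType) (v : I -> R) :
  (forall i, -1 <= v i) -> \prod_i (1 + v i) <= expR (\sum_i v i).
Proof.
move=> v1; rewrite expR_sum; apply: ler_prod => i _.
by rewrite expR_ge1Dx andbT; have := v1 i; lra.
Qed.

(** * Mean and lower bound for the mixture likelihood ratio *)

Section Estimates.
Variables (R : realType) (theta : R).

Lemma block_mean_geN1 n s m (g : 'I_s * 'I_m -> 'I_n) (a : R) b x :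
  (0 < m)%N -> 0 <= a <= 1 -> -1 <= block_mean g a b x.
Proof.
move=> m0 /andP[a0 a1].
have mR : 0 < m%:R :> R by rewrite ltr0n.
have : - m%:R <= spin_sum R (fun j => g (b, j)) x.
  have -> : - m%:R = \sum_(j < m) -1 :> R by rewrite sumr_const card_ord mulNrn.
  by apply: ler_sum => j _; rewrite /pm; case: (x _); lra.
rewrite /block_mean mulrAC ler_pdivlMr // => H.
have := ler_wpM2l a0 H; nra.
Qed.

Lemma sum_block_mean n s m (g : 'I_s * 'I_m -> 'I_n) (a : R) x :
  \sum_b block_mean g a b x = a / m%:R * spin_sum R g x.
Proof.
rewrite /block_mean -mulr_sumr /spin_sum pair_big /=; congr (_ * _).
by apply: eq_bigr => -[].
Qed.

Lemma mixture_lr_estimates (C : R) : 0 < C ->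
  exists K c N : R, [/\ 0 < K, 0 < c & 
  forall n s m (g : 'I_s * 'I_m -> 'I_n) a,
    (3 <= n)%N -> injective g -> (0 < m)%N -> (0 < s)%N -> (n <= 2 * (s * m))%N ->
    0 < a -> a < 1 -> s%:R * a <= C * Num.sqrt n%:R -> N <= Num.sqrt n%:R ->
    null_mean theta (mixture_lr g a) <= K /\
    forall T : test n,
      c * (4^-1 - null_mean theta (fun x => (T x)%:R)) <=
      null_mean theta (fun x => mixture_lr g a x * (~~ T x)%:R)].
Proof.
move=> C0.
have [K [D [K0 D0 mgf]]] := spin_sum_mgf theta.
have [M M0 moments] := spin_sum_moments theta.
(* Chosen so that [2 * M * q / A <= 2^-1] once [q <= 2 * C ^+ 2]. *)
set A := 8 * M * C ^+ 2.
have A0 : 0 < A by rewrite /A !mulr_gt0 // exprn_gt0.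
(* The threshold [256 * M * C ^+ 3] is what forces [64 * (M * r) <= 1] below. *)
exists (K * expR (D * (2 * C ^+ 2))), (expR (- (1 + 2 * A))), (256 * M * C ^+ 3).
split; [by rewrite mulr_gt0 ?expR_gt0 | exact: expR_gt0 |].
move=> n s m g a n3 g_inj m0 s0 nsm a0 a1 saC nN.
have a01 : 0 <= a <= 1 by rewrite !ltW.
have u_geN1 := fun b x => block_mean_geN1 g b x m0 a01.
set w := Num.sqrt n%:R in saC nN.
have nR : 0 < n%:R :> R by rewrite ltr0n; lia.
have w0 : 0 < w by rewrite sqrtr_gt0.
have w2 : w ^+ 2 = n%:R by rewrite sqr_sqrtr // ltW.
have mR : 0 < m%:R :> R by rewrite ltr0n.
have sR : 0 < s%:R :> R by rewrite ltr0n.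
have nsmR : w ^+ 2 <= 2 * (s%:R * m%:R) by rewrite w2 -!natrM ler_nat.
have sa0 : 0 < s%:R * a by rewrite mulr_gt0.
have sa2 : (s%:R * a) ^+ 2 <= C ^+ 2 * w ^+ 2.
  by rewrite -exprMn ler_pXn2r // nnegrE ltW // mulr_gt0.
(* Variance scale of the sum of the block means. *)
set q := s%:R * a ^+ 2 / m%:R.
have qm : q * m%:R = s%:R * a ^+ 2 by rewrite /q divfK // gt_eqF.
have q_le : q <= 2 * C ^+ 2.
  have q0 : 0 < q by rewrite /q divr_gt0 ?mulr_gt0 ?exprn_gt0.
  rewrite -(ler_pM2r (exprn_gt0 2 w0)).
  apply: le_trans (ler_wpM2l (ltW q0) nsmR) _.
  rewrite [leLHS](_ : _ = 2 * (s%:R * (q * m%:R))); last by ring.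
  by rewrite qm; move: sa2; rewrite exprMn; lra.
(* Scale of the sum of fourth moments of the block means; it decays like [w^-1]. *)
set r := s%:R * a ^+ 4 / m%:R ^+ 2.
have r_le : 64 * (M * r) <= 1.
  have r0 : 0 < r by rewrite /r divr_gt0 ?mulr_gt0 ?exprn_gt0.
  have rm : r * m%:R ^+ 2 = s%:R * a ^+ 4 by rewrite /r divfK // gt_eqF // exprn_gt0.
  have w4 : w ^+ 4 <= 4 * (s%:R * m%:R) ^+ 2.
    rewrite -[4%N]/(2 * 2)%N exprM.
    have -> : 4 * (s%:R * m%:R) ^+ 2 = (2 * (s%:R * m%:R)) ^+ 2 :> R by ring.
    by rewrite ler_pXn2r // nnegrE ?sqr_ge0 // !mulr_ge0 // ltW.
  have sa3 : (s%:R * a) ^+ 3 <= C ^+ 3 * w ^+ 3.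
    by rewrite -exprMn ler_pXn2r // nnegrE ltW // mulr_gt0.
  have sa3p : 0 < (s%:R * a) ^+ 3 by rewrite exprn_gt0.
  have rw4 : r * w ^+ 4 <= 4 * (C ^+ 3 * w ^+ 3).
    apply: le_trans (ler_wpM2l (ltW r0) w4) _.
    rewrite [leLHS](_ : _ = 4 * (s%:R ^+ 2 * (r * m%:R ^+ 2))); last by ring.
    rewrite rm [leLHS](_ : _ = 4 * ((s%:R * a) ^+ 3 * a)); last by ring.
    by nra.
  have w3 : 0 < w ^+ 3 by rewrite exprn_gt0.
  have rw : r * w <= 4 * C ^+ 3.
    by rewrite -(ler_pM2r w3) -[leLHS]mulrA -exprS -[leRHS]mulrA.
  have Mr0 : 0 < M * r by rewrite mulr_gt0.
  have : 64 * (M * r) * w <= w.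
    apply: le_trans nN.
    rewrite [leLHS](_ : _ = 64 * M * (r * w)); last by ring.
    rewrite [leRHS](_ : _ = 64 * M * (4 * C ^+ 3)); last by ring.
    by rewrite ler_wpM2l // mulr_ge0 // ltW.
  by rewrite -{2}[w]mul1r ler_pM2r.
have card_sm : #|{: 'I_s * 'I_m}| = (s * m)%N by rewrite card_prod !card_ord.
have asm : (a / m%:R) ^+ 2 * (s * m)%:R = q.
  by rewrite natrM /q; field; rewrite gt_eqF.
split.
  apply: le_trans (_ : null_mean theta (fun x => expR (a / m%:R * spin_sum R g x)) <= _).
    by apply: ler_null_mean => x; rewrite -sum_block_mean prod_1D_le.
  apply: le_trans (mgf n _ g _ n3 g_inj) _.
  by rewrite card_sm asm ler_pM2l // ler_expR ler_wpM2l.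
move=> T.
set Phi := fun x => ((\sum_b block_mean g a b x) ^+ 2 +
  \sum_b block_mean g a b x ^+ 2) / A + 16 * \sum_b block_mean g a b x ^+ 4.
have scale k (J : finType) (f : J -> 'I_n) :
    null_mean theta (fun x => (a / m%:R * spin_sum R f x) ^+ k) =
    (a / m%:R) ^+ k * null_mean theta (fun x => spin_sum R f x ^+ k).
  by rewrite -null_meanZ; apply: eq_bigr => x _; rewrite exprMn.
have am0 : 0 < a / m%:R by rewrite divr_gt0.
have S_le : null_mean theta (fun x => (\sum_b block_mean g a b x) ^+ 2) <= M * q.
  have sm0 : (0 < #|{: 'I_s * 'I_m}|)%N by rewrite card_sm muln_gt0 s0.
  have [mom2 _] := moments n _ g n3 g_inj sm0.
  rewrite [leLHS](_ : _ = null_mean theta (fun x => (a / m%:R * spin_sum R g x) ^+ 2)).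
    rewrite scale -asm mulrCA ler_wpM2l ?exprn_ge0 ?(ltW am0) //.
    by rewrite -card_sm.
  by apply: eq_bigr => x _; rewrite sum_block_mean.
have block b := moments n _ (fun j => g (b, j)) n3
  (fun i j e => congr1 snd (g_inj (b, i) (b, j) e)).
have Im0 : (0 < #|'I_m|)%N by rewrite card_ord.
have S2_le : null_mean theta (fun x => \sum_b block_mean g a b x ^+ 2) <= M * q.
  rewrite null_mean_sum.
  apply: le_trans (_ : \sum_(b < s) (a / m%:R) ^+ 2 * (M * m%:R) <= _).
    apply: ler_sum => b _; have [mom2 _] := block b Im0.
    by rewrite scale ler_wpM2l ?exprn_ge0 ?(ltW am0) // -[m in leRHS]card_ord.
  rewrite sumr_const card_ord -[leLHS]mulr_natr -asm natrM le_eqVlt; apply/orP; left; apply/eqP.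
  by ring.
have S4_le : null_mean theta (fun x => \sum_b block_mean g a b x ^+ 4) <= M * r.
  rewrite null_mean_sum.
  apply: le_trans (_ : \sum_(b < s) (a / m%:R) ^+ 4 * (M * m%:R ^+ 2) <= _).
    apply: ler_sum => b _; have [_ mom4] := block b Im0.
    by rewrite scale ler_wpM2l ?exprn_ge0 ?(ltW am0) // -[m in leRHS]card_ord.
  rewrite sumr_const card_ord -[leLHS]mulr_natr /r le_eqVlt; apply/orP; left; apply/eqP.
  by field; rewrite gt_eqF.
(* The quadratic part contributes at most [2^-1], the fourth powers at most
   [16 * (M * r) <= 4^-1]. *)
have Phi_le : null_mean theta Phi <= 3 / 4.
  rewrite /Phi null_meanD null_meanZ.
  rewrite [X in X + _](_ : _ = A^-1 *
     (null_mean theta (fun x => (\sum_b block_mean g a b x) ^+ 2) +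
      null_mean theta (fun x => \sum_b block_mean g a b x ^+ 2))); last first.
    by rewrite -null_meanD -null_meanZ; apply: eq_bigr => x _; rewrite (mulrC A^-1).
  have : A^-1 * (null_mean theta (fun x => (\sum_b block_mean g a b x) ^+ 2) +
      null_mean theta (fun x => \sum_b block_mean g a b x ^+ 2)) <= 2^-1.
    rewrite ler_pdivrMl //.
    have := ler_wpM2l (ltW M0) q_le; rewrite /A; lra.
  lra.
(* Subtracting the indicator of rejection makes the bound nonpositive where [T] rejects and leaves
   [prod_1D_ge] where it accepts. *)
apply: le_trans (_ : null_mean theta
    (fun x => expR (- (1 + 2 * A)) * (1 + -1 * (Phi x + (T x)%:R))) <= _).
  rewrite null_meanZ ler_pM2l ?expR_gt0 //.
  rewrite null_meanD null_mean1 null_meanZ null_meanD; lra.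
apply: ler_null_mean => x.
have Phi_ge0 : 0 <= Phi x.
  rewrite addr_ge0 // ?mulr_ge0 ?invr_ge0 ?(ltW A0) ?addr_ge0 ?sqr_ge0 ?sumr_ge0 // => b _.
    exact: sqr_ge0.
  by rewrite exprn_even_ge0.
case: (T x) => /=; rewrite ?mulr0 ?mulr1.
  by rewrite mulr_ge0_le0 ?expR_ge0 //; lra.
by rewrite addr0 mulN1r; exact: prod_1D_ge.
Qed.
End Estimates.

(** * Risk lower bound *)

Lemma limn_esup_ge (R : realType) (v : nat -> \bar R) (l : \bar R) (N : nat) :
  (forall n, (N <= n)%N -> (l <= v n)%E) -> (l <= limn_esup v)%E.
Proof.
move=> Hv; rewrite limn_esup_lim (cvg_lim _ (@cvg_esups_inf _ v)) //.
apply: le_ereal_inf_tmp => _ [n _ <-].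
apply: le_trans (Hv (maxn n N) (leq_maxr _ _)) _.
by apply: ereal_sup_ubound; exists (maxn n N) => //=; exact: leq_maxl.
Qed.

(** Both summands of the risk are nonnegative; [mu0] keeps the supremum from being taken over the
    empty set, where it would be [-oo]. *)
Lemma risk_components (R : realType) (n s : nat) (Q : 'M[R]_n) (B d : R)
    (T : test n) (mu0 : 'cV[R]_n) :
  Xi s B mu0 -> (risk Q s B T < d%:E)%E ->
  ising_prob Q 0 [set x | T x] <= d /\
  forall mu, Xi s B mu -> ising_prob Q mu [set x | ~~ T x] <= d.
Proof.
move=> mu0P; rewrite /risk.
have prob_ge0 mu (E : {set config n}) : 0 <= ising_prob Q mu E.
  by apply: sumr_ge0 => x _; exact: ising_pmf_ge0.
set S := [set _ | _ in _]%classic => riskd.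
have Sub mu : Xi s B mu -> ((ising_prob Q mu [set x | ~~ T x])%:E <= ereal_sup S)%E.
  by move=> muP; apply: ereal_sup_ubound; exists mu.
have S0 : (0 <= ereal_sup S)%E by apply: le_trans (Sub _ mu0P); rewrite lee_fin.
split=> [|mu muP]; rewrite -lee_fin; apply: le_trans (ltW riskd).
  by rewrite leeDl.
by apply: le_trans (Sub _ muP) _; rewrite leeDr // lee_fin.
Qed.

Lemma null_mean_prob (R : realType) (theta : R) n (T : test n) :
  null_mean theta (fun x => (T x)%:R) = ising_prob (cycleQ theta n) 0 [set x | T x].
Proof.
rewrite /null_mean /ising_prob [RHS]big_mkcond /=; apply: eq_bigr => x _.
by rewrite inE; case: (T x); rewrite ?mulr0 ?mulr1.
Qed.

Lemma injection_into_ord (T : finType) n : (#|T| <= n)%N ->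
  exists g : T -> 'I_n, injective g.
Proof.
move=> Tn; exists (fun x => widen_ord Tn (enum_rank x)) => x y /(congr1 val) /=.
by move=> /val_inj /enum_rank_inj.
Qed.

(** A risk below [d] would give [c * (4^-1 - d) <= d * K], that is [c / 4 <= d * (K + c)], whereas
    [d] is set so that the right side is [c / 8]. *)
Lemma eventually_risk_ge (R : realType) (theta C : R) : 0 < C ->
  exists2 d : R, 0 < d & exists N : nat,
    forall (n s : nat) (B : R) (T : test n),
      (N <= n)%N -> (1 <= s <= n)%N -> 0 < B ->
      s%:R * tanh B <= C * Num.sqrt n%:R ->
      (d%:E <= risk (cycleQ theta n) s B T)%E.
Proof.
move=> C0; have [K [c [N [K0 c0 est]]]] := mixture_lr_estimates theta C0.
set d := c / (8 * (K + c)).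
have Kc : 0 < K + c by rewrite addr_gt0.
have d0 : 0 < d by rewrite divr_gt0 // mulr_gt0.
have dE : d * (K + c) = c / 8 by rewrite /d; field; rewrite gt_eqF.
exists d => //; exists (maxn 3 (Num.bound (N ^+ 2))) => n s B T.
rewrite geq_max => /andP[n3 Nn] /andP[s0 sn] B0 sB.
have N_le : N <= Num.sqrt n%:R.
  apply: le_trans (ler_norm _) _; rewrite -sqrtr_sqr ler_wsqrtr //.
  by apply: ltW; apply: lt_le_trans (archi_boundP (sqr_ge0 _)) _; rewrite ler_nat.
rewrite leNgt; apply/negP => riskd.
set m := (n %/ s)%N.
have m0 : (0 < m)%N by rewrite divn_gt0.
have smn : (s * m <= n)%N by rewrite mulnC leq_trunc_div.
(* Flooring loses less than one block size [s], and [s <= s * m]. *)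
have nsm : (n <= 2 * (s * m))%N.
  have : (n < m.+1 * s)%N by rewrite -ltn_divLR.
  rewrite mulSn; move: (leq_pmull s m0) => {smn}; lia.
have [g g_inj] : exists g : 'I_s * 'I_m -> 'I_n, injective g.
  by apply: injection_into_ord; rewrite card_prod !card_ord.
pose phi0 : {ffun 'I_s -> 'I_m} := [ffun=> Ordinal m0].
have [p_le r_le] := risk_components (planted_Xi g_inj phi0 B0) riskd.
have [LK Lc] := est n s m g _ n3 g_inj m0 s0 nsm (tanh_gt0 B0) (tanh_lt1 B) sB N_le.
have := mixture_type2 g_inj m0 (fun phi => r_le _ (planted_Xi g_inj phi B0)).
have := Lc T; rewrite null_mean_prob => H1 H2.
have H3 := ler_wpM2l (ltW d0) LK.
have H4 := ler_wpM2l (ltW c0) p_le.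
lra.
Qed.

Unset Implicit Arguments.
Set Strict Implicit.

Theorem theorem5 (R : realType) (theta : R) (s : nat -> nat) (B : nat -> R)
  (hs : forall n : nat, (3 <= n)%N -> (1 <= s n <= n)%N)
  (hB : forall n : nat, (3 <= n)%N -> 0 < B n)
  (C : R) (hC : 0 < C)
  (hsB : forall n : nat, (3 <= n)%N ->
    (s n)%:R * tanh (B n) <= C * Num.sqrt (n%:R : R)) :
  forall T : (forall n : nat, test n),
    ~ asymptotically_powerful (cycleQ theta) s B T.
Proof.
move=> T.
have [d d0 [N HN]] := eventually_risk_ge theta hC.
rewrite /asymptotically_powerful => H0.
have : (d%:E <= limn_esup (fun n => risk (cycleQ theta n) (s n) (B n) (T n)))%E.
  apply: (@limn_esup_ge _ _ _ (maxn 3 N)) => n; rewrite geq_max => /andP[n3 Nn].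
  by apply: HN; [|exact: hs|exact: hB|exact: hsB].
by rewrite H0 lee_fin leNgt d0.
Qed.
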